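(* Let $p>3$ be a prime. Then $$T_{p-1}\equiv\left(\frac p3\right)3^{p-1}\pmod{p^2}$$ and $$\sum_{k=0}^{p-1}\binom{p-1}{k}\binom{2k}{k}\left((-1)^k-(-3)^{-k}\right)\equiv\left(\frac p3\right)(3^{p-1}-1)\pmod{p^3}.$$
   Context: For $n\in\mathbb N=\{0,1,2,\dots\}$, the central trinomial coefficient $T_n$ is the constant term in the expansion of $(1+x+x^{-1})^n$; equivalently $T_n=\sum_{j=0}^{\lfloor n/2\rfloor}\binom{n}{j}\binom{n-j}{j}$. $\left(\frac{\cdot}{3}\right)$ denotes the Legendre symbol modulo $3$. Congruences between rational numbers whose denominators are prime to $p$ are understood in the ring of $p$-integral rationals. *)

(* Defs.v *)
From HB Require Import structures.
From mathcomp Require Import all_boot all_order all_algebra.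
From mathcomp Require Import zify.

Set Implicit Arguments.
Unset Strict Implicit.
Unset Printing Implicit Defensive.

Import Order.TTheory GRing.Theory Num.Theory.
Local Open Scope ring_scope.

(* The constant term of (1 + x + x^-1)^n = x^-n (1 + x + x^2)^n is the
   coefficient of x^n in (1 + x + x^2)^n; see [trinomial_laurent] and
   [central_trinomialE]. *)
Definition central_trinomial (n : nat) : int :=
  ((1 + 'X + 'X^2 : {poly int}) ^+ n)`_n.

Lemma trinomial_laurent (n : nat) :
  let x : {fraction {poly int}} := FracField.tofrac 'X in
  (1 + x + x^-1) ^+ n =
    x ^- n * \sum_(i < n.*2.+1)
               (((1 + 'X + 'X^2 : {poly int}) ^+ n)`_i)%:~R * x ^+ i.
Proof.
move=> x; have x0 : x != 0 by rewrite tofrac_eq0 polyX_eq0.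
have -> : 1 + x + x^-1 = x^-1 * (1 + x + x ^+ 2).
  by rewrite !mulrDr mulr1 mulVf // expr2 mulrA mulVf // mul1r addrC addrA.
rewrite exprMn exprVn; congr (_ * _).
set q := (1 + 'X + 'X^2 : {poly int}).
have -> : 1 + x + x ^+ 2 = FracField.tofrac q.
  by rewrite !rmorphD rmorph1 rmorphXn.
have sq : (size q <= 3)%N.
  rewrite (leq_trans (size_polyD _ _)) // geq_max size_polyXn leqnn andbT.
  rewrite (leq_trans (size_polyD _ _)) // geq_max size_poly1 size_polyX //.
have sqn : (size (q ^+ n) <= n.*2.+1)%N.
  apply: leq_trans (size_poly_exp_leq _ _) _.
  rewrite ltnS -mul2n leq_mul2r; apply/orP; right.
  by case: (size q) sq.
rewrite -rmorphXn -[in LHS](coefK (q ^+ n)) poly_def rmorph_sum /=.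
rewrite (big_ord_widen _ (fun i => FracField.tofrac ((q ^+ n)`_i *: 'X^i)) sqn).
rewrite big_mkcond /=; apply: eq_bigr => i _.
case: ltnP => [_|le]; last by rewrite nth_default // mul0r.
by rewrite -[in LHS](intz (q ^+ n)`_i) scaler_int rmorphMz rmorphXn mulrzl.
Qed.

Lemma central_trinomialE (n : nat) :
  central_trinomial n =
    (\sum_(j < n./2.+1) 'C(n, j) * 'C(n - j, j))%N%:Z.
Proof.
rewrite /central_trinomial.
have -> : 1 + 'X + 'X^2 = 'X * ('X + 1) + 1 :> {poly int}.
  by rewrite mulrDr mulr1 -expr2 -addrA addrC ['X + _]addrC.
rewrite exprDn coef_sum.
pose F j := ('C(n, j) * 'C(n - j, j))%N.
have -> : (\sum_(j < n./2.+1) 'C(n, j) * 'C(n - j, j) = \sum_(j < n.+1) F j)%N.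
  have le : (n./2.+1 <= n.+1)%N by lia.
  rewrite (big_ord_widen _ F le) big_mkcond; apply: eq_bigr => j _.
  by case: ltnP => // lt; rewrite /F ['C(n - j, j)]bin_small ?muln0 //; lia.
rewrite -natz natr_sum; apply: eq_bigr => j _.
have lej : (j <= n)%N by have := ltn_ord j; lia.
rewrite coefMn expr1n mulr1 exprMn coefXnM ltnNge leq_subr /= subKn //.
rewrite exprDn coef_sum.
have -> : \sum_(i < (n - j).+1) ('X ^+ (n - j - i) * 1 ^+ i *+ 'C(n - j, i))`_j
        = ('C(n - j, j))%:R :> int.
  under eq_bigr => i _ do rewrite expr1n mulr1 coefMn coefXn.
  case: (ltnP (n - j) j) => h.
    rewrite bin_small // big1 // => i _; case: eqP => [e|_]; last by rewrite mul0rn.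
    by lia.
  have hk : (n - j - j < (n - j).+1)%N by lia.
  rewrite (bigD1 (Ordinal hk)) //= subKn // eqxx big1 ?addr0 => [|i ne].
    by rewrite bin_sub.
  case: eqP => [e|_]; last by rewrite mul0rn.
  by case/eqP: ne; apply: val_inj => /=; have := ltn_ord i; lia.
by rewrite /F mulnC natrM mulr_natr.
Qed.

Definition legendre (a : int) (q : nat) : int :=
  if (q%:Z %| a)%Z then 0
  else if [exists x : 'I_q, (x%:Z ^+ 2 == a %[mod q%:Z])%Z] then 1
  else -1.

Definition p_integral (p : nat) (x : rat) : bool := coprime p `|denq x|%N.

(* Congruence modulo p^m in the ring Z_(p) of p-integral rationals. *)
Definition congr_pint (p m : nat) (x y : rat) : Prop :=
  [/\ p_integral p x, p_integral p y &
      exists2 z : rat, p_integral p z & x - y = (p%:R ^+ m) * z].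

(* Main.v *)
Require Import Defs.
From mathcomp Require Import all_boot all_order all_algebra.
From mathcomp Require Import all_solvable all_field zify ring.

Import Order.TTheory GRing.Theory Num.Theory.
Local Open Scope ring_scope.

(** Let [v] be a primitive cube root of unity, [n = p - 1] and [e = (p/3)].
    Since [1 + x + x^2 = (x - v)(x - v^2)], the coefficient [T_n] is
    [\sum_k C(n,k)^2 v^(n+k)].  As [C(n,k) = (-1)^k] modulo [p], squaring the
    difference gives [C(n,k)^2 = 2 (-1)^k C(n,k) - 1] modulo [p^2], whence
    [T_n = 2a - e] modulo [p^2], where [a = v^n (1 - v)^n = (-3)^(n/2)].
    The same expansion gives [a = e] modulo [p], so
    [e (a - e)^2 = e a^2 - 2a + e] vanishes modulo [p^2], and
    [T_n = e a^2 = e 3^n].  For the second congruence, the decompositions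
    [1 + x + 1/x = (x + 2 + 1/x) - 1 = (x - 2 + 1/x) + 3] show that the sum is
    exactly [T_n - T_n / 3^n = T_n (3^n - 1) / 3^n]. *)

(** The truncated exponent [m - k] is harmless for [k > m], where the binomial coefficient is
    zero. *)
Lemma coef_XaddC_exp (R : comNzRingType) (s : R) (m k : nat) :
  (('X + s%:P) ^+ m)`_k = s ^+ (m - k) *+ 'C(m, k).
Proof.
rewrite addrC exprDn coef_sum.
under eq_bigr => i _ do rewrite coefMn -rmorphXn mul_polyC coefZ coefXn.
have [le_km|lt_mk] := leqP k m.
  have lt_km : (k < m.+1)%N by [].
  rewrite (bigD1 (Ordinal lt_km)) //= eqxx mulr1 big1 ?addr0 // => i ne_ik.
  case: eqP => [e|]; last by rewrite mulr0 mul0rn.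
  by case/eqP: ne_ik; apply: val_inj.
rewrite bin_small // mulr0n big1 // => i _; case: eqP => [e|].
  by have := ltn_ord i; lia.
by rewrite mulr0 mul0rn.
Qed.

(** Both decompositions of [1 + 'X + 'X^2] have this shape, with [(c, s)] equal to [(-1, 1)] and
    [(3, -1)]. In the binomial expansion, the factor ['X ^+ (n - k)] leaves the middle coefficient
    of [('X + s%:P) ^+ (2 * k)]. *)
Lemma coef_quadratic_exp (R : comNzRingType) (c s : R) (n : nat) :
  ((c *: 'X + ('X + s%:P) ^+ 2) ^+ n)`_n =
  \sum_(k < n.+1) c ^+ (n - k) * s ^+ k * ('C(n, k) * 'C(2 * k, k))%:R.
Proof.
rewrite exprDn coef_sum; apply: eq_bigr => k _.
have le_kn : (k <= n)%N by have := ltn_ord k; lia.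
rewrite coefMn exprZn -scalerAl coefZ coefXnM ltnNge leq_subr /= subKn //.
rewrite -exprM coef_XaddC_exp -mulrA -mulrnAr; congr (_ * _).
have -> : (2 * k - k = k)%N by lia.
by rewrite -mulrnA mulr_natr mulnC.
Qed.

Lemma central_trinomial_sum_m1 (n : nat) : ~~ odd n ->
  central_trinomial n =
  \sum_(k < n.+1) (-1) ^+ k * ('C(n, k) * 'C(2 * k, k))%:R.
Proof.
move=> even_n; rewrite /central_trinomial.
have -> : 1 + 'X + 'X^2 = (-1) *: 'X + ('X + 1%:P) ^+ 2 :> {poly int}.
  by rewrite scaleN1r; ring.
rewrite coef_quadratic_exp; apply: eq_bigr => k _.
rewrite expr1n mulr1 -[in LHS]signr_odd oddB; last by have := ltn_ord k; lia.
by rewrite (negbTE even_n) /= signr_odd.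
Qed.

Lemma central_trinomial_sum_3 (n : nat) :
  central_trinomial n =
  \sum_(k < n.+1) 3 ^+ (n - k) * (-1) ^+ k * ('C(n, k) * 'C(2 * k, k))%:R.
Proof.
rewrite /central_trinomial.
have -> : 1 + 'X + 'X^2 = 3 *: 'X + ('X + (-1)%:P) ^+ 2 :> {poly int}.
  by rewrite scaler_nat polyCN; ring.
exact: coef_quadratic_exp.
Qed.

Lemma central_trinomial_cube_root (v : algC) (n : nat) :
  1 + v + v ^+ 2 = 0 -> ~~ odd n ->
  (central_trinomial n)%:~R = \sum_(k < n.+1) 'C(n, k)%:R ^+ 2 * v ^+ (n + k).
Proof.
move=> v0 even_n; have v2 : v ^+ 2 = - 1 - v.
  by rewrite -[LHS](addKr (1 + v)) v0; ring.
rewrite /central_trinomial -(coef_map (intr : int -> algC)).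
rewrite rmorphXn !rmorphD rmorph1 /= map_polyXn map_polyX.
have -> : 1 + 'X + 'X^2 = ('X + (- v)%:P) * ('X + (- v ^+ 2)%:P) :> {poly algC}.
  have v3 : v ^+ 3 = 1.
    by ring: v2.
  have -> : ('X + (- v)%:P) * ('X + (- v ^+ 2)%:P)
          = 'X ^+ 2 - (v + v ^+ 2)%:P * 'X + (v ^+ 3)%:P :> {poly algC}.
    by rewrite !(polyCD, polyCN, rmorphXn) /=; ring.
  have -> : v + v ^+ 2 = -1 by ring: v2.
  by rewrite v3 polyCN; ring.
rewrite exprMn coefM; apply: eq_bigr => k _.
have le_kn : (k <= n)%N by have := ltn_ord k; lia.
(* The factors contribute [(- v) ^+ (n - k)] and [(- v ^+ 2) ^+ k]: the exponents of [v] add up to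
   [n + k], and the signs cancel because [n] is even. *)
rewrite !coef_XaddC_exp bin_sub // subKn // (exprNn v) (exprNn (v ^+ 2)) -[v ^+ 2 ^+ k]exprM.
rewrite -!(mulr_natr (_ * _)).
have -> : (n + k = n - k + 2 * k)%N by lia.
have sgn : (-1) ^+ (n - k) * (-1) ^+ k = 1 :> algC.
  by rewrite -exprD subnK // -signr_odd (negbTE even_n).
by rewrite exprD; ring: sgn.
Qed.

(** By Pascal's rule, neighbouring entries of row [p.-1] add up to an entry of row [p] divisible by
    [p], so they are opposite modulo [p]. *)
Lemma bin_prime_pred (p k : nat) : prime p -> (k < p)%N ->
  (p%:Z %| 'C(p.-1, k)%:Z - (-1) ^+ k)%Z.
Proof.
move=> p_pr; elim: k => [|k IHk] lt_kp; first by rewrite bin0 subrr dvdz0.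
have := IHk (ltnW lt_kp); have p_gt0 := prime_gt0 p_pr.
have : (p%:Z %| 'C(p, k.+1)%:Z)%Z by apply: prime_dvd_bin; rewrite // lt_kp.
rewrite -[in 'C(p, _)](prednK p_gt0) binS PoszD => dvd1 dvd2.
have -> : 'C(p.-1, k.+1)%:Z - (-1) ^+ k.+1 =
  ('C(p.-1, k.+1)%:Z + 'C(p.-1, k)%:Z) - ('C(p.-1, k)%:Z - (-1) ^+ k).
  by rewrite exprS; ring.
exact: rpredB.
Qed.

Lemma even_prime_pred (p : nat) : prime p -> (2 < p)%N -> ~~ odd p.-1.
Proof.
move=> p_pr; have [->//|] := even_prime p_pr.
by rewrite -[in odd p](prednK (prime_gt0 p_pr)).
Qed.

Lemma legendre3E (a : nat) :
  legendre a%:Z 3 = if (a %% 3 == 0)%N then 0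
                    else if (a %% 3 == 1)%N then 1 else -1.
Proof.
rewrite /legendre dvdzE !absz_nat /dvdn; case: ifP => // a3.
have lt3 : (a %% 3 < 3)%N by rewrite ltn_mod.
have sq (x : nat) : (x%:Z ^+ 2 == a %[mod 3%:Z])%Z = ((x ^ 2) %% 3 == a %% 3)%N.
  by rewrite expr2 -PoszM !modz_nat.
have -> : [exists x : 'I_3, (x%:Z ^+ 2 == a%:Z %[mod 3%:Z])%Z] = (a %% 3 == 1)%N.
  apply/existsP/eqP => [[x]|a1].
    rewrite sq => /eqP; case: x => [[|[|[|x]]] //= ltx] e.
    by move: a3; rewrite -e.
  by exists (@Ordinal 3 1 isT); rewrite sq /= a1.
by case: eqP.
Qed.

Lemma sum_cube_root (v : algC) (p : nat) :
  1 + v + v ^+ 2 = 0 -> (0 < p)%N ->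
  v ^+ p.-1 * (\sum_(k < p) v ^+ k) = (legendre p%:Z 3)%:~R.
Proof.
move=> v0 p_gt0; have v2 : v ^+ 2 = - 1 - v.
  by rewrite -[LHS](addKr (1 + v)) v0; ring.
have v3 : v ^+ 3 = 1.
  by ring: v2.
have neq_v1 : 1 - v != 0.
  apply/eqP => v1; have v1' : v = 1 by rewrite -[LHS](subKr 1) v1 subr0.
  have : 3 = 0 :> algC by rewrite -v0 v1' expr1n; ring.
  by move/eqP; rewrite pnatr_eq0.
(* Multiplying by [1 - v] sums the geometric series; a further factor [v] turns the left side into
   [v ^+ p * (1 - v ^+ p)], which depends only on [p] modulo 3. *)
apply: (mulfI neq_v1); rewrite mulrCA -opprB mulNr -subrX1 opprB.
apply: (mulfI (_ : v != 0)).
  by apply/eqP => vz; move/eqP: v0; rewrite vz expr0n !addr0 oner_eq0.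
have vp : v * v ^+ p.-1 = v ^+ p by rewrite -exprS prednK.
rewrite [LHS]mulrA vp opprB legendre3E.
rewrite (divn_eq p 3) exprD mulnC exprM v3 expr1n mul1r mulnC modnMDl modn_mod.
have : (p %% 3 < 3)%N by rewrite ltn_mod.
case: (p %% 3)%N => [|[|[|//]]] _ /=.
- by rewrite expr0 subrr !mulr0.
- by rewrite expr1 mulr1.
- by ring: v2.
Qed.

Lemma central_trinomial_pred_prime (p : nat) : prime p -> (3 < p)%N ->
  (central_trinomial p.-1 = legendre p%:Z 3 * 3%:Z ^+ p.-1 %[mod p%:Z ^+ 2])%Z.
Proof.
move=> p_pr p_gt3; have p_gt0 := prime_gt0 p_pr.
have even_n : ~~ odd p.-1 by rewrite even_prime_pred ?(ltnW p_gt3).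
have [v prim_v] := C_prim_root_exists (isT : (0 < 3)%N).
have v0 : 1 + v + v ^+ 2 = 0.
  have neq_v1 : v - 1 != 0.
    by rewrite subr_eq0 -[v]expr1 -(prim_order_dvd prim_v).
  apply: (mulfI neq_v1); rewrite mulr0.
  by have v3 := prim_expr_order prim_v; ring: v3.
have v2 : v ^+ 2 = - 1 - v.
  by rewrite -[LHS](addKr (1 + v)) v0; ring.
set n := p.-1 in even_n *; set e := legendre p%:Z 3.
have e2 : e ^+ 2 = 1.
  rewrite /e legendre3E; case: eqP => [p3|_]; last by case: ifP.
  have : (3 %| p)%N by rewrite /dvdn p3.
  by rewrite dvdn_prime2 // => /eqP p3'; rewrite -p3' in p_gt3.
pose c (k : 'I_p) : int := (('C(n, k)%:Z - (-1) ^+ k) %/ p%:Z)%Z.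
have binE (k : 'I_p) : 'C(n, k)%:R = (-1) ^+ k + p%:R * (c k)%:~R :> algC.
  have /divzK := bin_prime_pred p k p_pr (ltn_ord k).
  rewrite -/n -/(c k) => ck.
  have {ck} : 'C(n, k)%:Z = (-1) ^+ k + p%:Z * c k by rewrite mulrC ck; ring.
  by move/(congr1 (intr : int -> algC)); rewrite rmorphD rmorphM rmorphXn rmorphN1.
pose a : int := (-3) ^+ n./2.
have aE : a%:~R = \sum_(k < p) (-1) ^+ k * 'C(n, k)%:R * v ^+ (n + k) :> algC.
  have -> : \sum_(k < p) (-1) ^+ k * 'C(n, k)%:R * v ^+ (n + k)
          = v ^+ n * (1 - v) ^+ n.
    rewrite exprBn -/n prednK // mulr_sumr; apply: eq_bigr => k _.
    by rewrite expr1n -mulr_natr exprD; ring.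
  have -> : n = (2 * n./2)%N by have := even_n; lia.
  (* [v * (1 - v)] is a square root of -3. *)
  rewrite -exprMn exprM /a rmorphXn /=; congr (_ ^+ _).
  by rewrite rmorphN; ring: v2.
have eE : e%:~R = \sum_(k < p) v ^+ (n + k) :> algC.
  rewrite -(sum_cube_root v) // mulr_sumr.
  by apply: eq_bigr => k _; rewrite exprD.
pose y := \sum_(k < p) (-1) ^+ k * (c k)%:~R * v ^+ (n + k).
pose z := \sum_(k < p) (c k)%:~R ^+ 2 * v ^+ (n + k).
have sgn2 k : (-1) ^+ k * (-1) ^+ k = 1 :> algC by rewrite -expr2 sqrr_sign.
have ay : a%:~R = e%:~R + p%:R * y.
  rewrite aE eE /y mulr_sumr -big_split /=; apply: eq_bigr => k _.
  by rewrite binE mulrDr sgn2; ring.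
(* Termwise, with [s = (-1) ^+ k] and [b = s + p * c k], this is [b ^+ 2 = 2 * s * b - 1 + p ^+ 2 *
   c k ^+ 2]. *)
have Tz : (central_trinomial n)%:~R = 2 * a%:~R - e%:~R + p%:R ^+ 2 * z.
  rewrite (central_trinomial_cube_root v) // prednK // aE eE /z !mulr_sumr.
  rewrite -sumrB -big_split /=; apply: eq_bigr => k _.
  by rewrite binE; have := sgn2 k; move: ((-1) ^+ k) => s ss; ring: ss.
have Aint_v : v \in Aint by apply: Aint_prim_root prim_v.
have Aint_y : y \in Aint.
  by apply: rpred_sum => k _; rewrite !rpredM ?rpredX ?Aint_int ?rpredN1.
have Aint_z : z \in Aint.
  by apply: rpred_sum => k _; rewrite !rpredM ?rpredX ?Aint_int.
have a2 : a ^+ 2 = 3%:Z ^+ n.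
  rewrite /a -exprM mulnC exprM sqrrN -exprM; congr (_ ^+ _).
  by have := even_n; lia.
apply/eqP; rewrite eqz_mod_dvd -a2.
(* Since [e ^+ 2 = 1], the difference is [p ^+ 2 * z - e * (a - e) ^+ 2], and [a - e = p * y]. *)
have TE : (central_trinomial n - e * a ^+ 2)%:~R
  = p%:R ^+ 2 * (z - e%:~R * y ^+ 2) :> algC.
  rewrite rmorphB rmorphM rmorphXn /= Tz ay.
  have : (e ^+ 2)%:~R = 1 :> algC by rewrite e2.
  by rewrite rmorphXn /= => ee; ring: ee.
have p2_neq0 : p%:R ^+ 2 != 0 :> algC by rewrite expf_eq0 pnatr_eq0 -lt0n p_gt0.
(* The cofactor is an algebraic integer, and rational as an integer divided by [p ^+ 2]; hence it is
   an integer, and the divisibility descends from [algC] to [int]. *)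
have /intrP[q qE] : z - e%:~R * y ^+ 2 \in Num.int.
  apply: Cint_rat_Aint.
    rewrite -[X in X \in _](mulKf p2_neq0) -TE.
    by rewrite rpredM ?rpredV ?rpredX ?rpred_nat ?rpred_int.
  by rewrite rpredB ?rpredM ?rpredX ?Aint_int.
apply/dvdzP; exists q; apply: (@intr_inj algC).
by rewrite TE qE rmorphM rmorphXn mulrC.
Qed.

(** The reduced denominator divides [d], by cross-multiplication and coprimality with the
    numerator. *)
Lemma p_integral_frac (p d : nat) (a : int) : coprime p d -> (0 < d)%N ->
  p_integral p (a%:~R / d%:R).
Proof.
move=> co_pd d_gt0; rewrite /p_integral; apply: coprime_dvdr co_pd.
set x := _ / _; have nz_d : d%:R != 0 :> rat by rewrite pnatr_eq0 -lt0n.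
have : numq x * d%:Z = a * denq x.
  apply: (@intr_inj rat); rewrite !rmorphM /= numqE -pmulrn mulrAC.
  by rewrite [X in X * _]divfK.
move=> /(congr1 absz); rewrite !abszM absz_nat => E.
have : (`|denq x| %| `|numq x| * d)%N by rewrite E dvdn_mull.
by rewrite Gauss_dvdr // coprime_sym coprime_num_den.
Qed.

Theorem theorem1p1 (p : nat) (p_prime : prime p) (p_gt3 : (3 < p)%N) :
  (central_trinomial p.-1 = legendre p%:Z 3 * 3%:Z ^+ p.-1 %[mod p%:Z ^+ 2])%Z
  /\
  congr_pint p 3
    (\sum_(0 <= k < p)
       'C(p.-1, k)%:R * 'C(2 * k, k)%:R * ((-1) ^+ k - (-3%:R) ^- k))
    ((legendre p%:Z 3)%:~R * (3%:R ^+ p.-1 - 1)).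
Proof.
have p_gt0 := prime_gt0 p_prime.
have T_mod := central_trinomial_pred_prime p p_prime p_gt3.
split=> //; set n := p.-1 in T_mod *; set e := legendre p%:Z 3 in T_mod *.
set T := central_trinomial n in T_mod.
have even_n : ~~ odd n by rewrite even_prime_pred ?(ltnW p_gt3).
have co_p3 : coprime 3 p.
  by rewrite prime_coprime // dvdn_prime2 //; apply: contraTN p_gt3 => /eqP <-.
have co_p3n : coprime p (3 ^ n) by rewrite coprimeXr // coprime_sym.
have gt0_3n : (0 < 3 ^ n)%N by rewrite expn_gt0.
have nz3 : 3%:R != 0 :> rat by [].
have nz3n : 3%:R ^+ n != 0 :> rat by rewrite expf_neq0.
have -> : \sum_(0 <= k < p) 'C(n, k)%:R * 'C(2 * k, k)%:R
            * ((-1) ^+ k - (-3%:R) ^- k) = T%:~R * (3%:R ^+ n - 1) / 3%:R ^+ n :> rat.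
  (* The [(-1) ^+ k] part of the sum is the first expansion of [T]; the [(-3) ^- k] part is the
     second one divided by [3 ^+ n]. *)
  have -> : T%:~R * (3%:R ^+ n - 1) / 3%:R ^+ n = T%:~R - T%:~R / 3%:R ^+ n :> rat.
    by field.
  rewrite {1}/T central_trinomial_sum_m1 // /T central_trinomial_sum_3.
  rewrite prednK // !rmorph_sum /= mulr_suml -sumrB big_mkord.
  apply: eq_bigr => k _; have lekn : (k <= n)%N by have := ltn_ord k; lia.
  rewrite !rmorphM !rmorphXn rmorphN1 !rmorph_nat /=.
  have -> : (-3%:R) ^- k = (-1) ^+ k * 3%:R ^- k :> rat.
    by rewrite exprNn invfM invr_sign.
  have -> : 3%:R ^+ (n - k) = 3%:R ^+ n / 3%:R ^+ k :> rat.
    by rewrite expfB_cond // (negbTE nz3).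
  by field; rewrite nz3n expf_neq0.
have [q qE] : exists q, T - e * 3%:Z ^+ n = q * p%:Z ^+ 2.
  by apply/dvdzP; rewrite -eqz_mod_dvd; apply/eqP.
have [r rE] : exists r, 3%:Z ^+ n - 1 = r * p%:Z.
  apply/dvdzP; rewrite -eqz_mod_dvd.
  have -> : 3%:Z ^+ n = (3 ^ n)%N by rewrite -!natz natrX.
  (* Fermat's little theorem, as Euler's theorem with totient [p.-1]. *)
  by rewrite !modz_nat eqz_nat /n -(totient_prime p_prime) Euler_exp_totient.
split.
- have -> : T%:~R * (3%:R ^+ n - 1) / 3%:R ^+ n
          = (T * (3%:Z ^+ n - 1))%:~R / (3 ^ n)%N%:R :> rat.
    by rewrite rmorphM rmorphB rmorphXn natrX.
  exact: p_integral_frac.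
- have -> : e%:~R * (3%:R ^+ n - 1) = (e * (3%:Z ^+ n - 1))%:~R / 1%N%:R :> rat.
    by rewrite rmorphM rmorphB rmorphXn divr1.
  by apply: p_integral_frac; rewrite ?coprimen1.
(* The difference factors as [(T - e * 3 ^+ n) * (3 ^+ n - 1) / 3 ^+ n]; the first factor supplies
   [p ^+ 2] and the second one more [p]. *)
exists ((q * r)%:~R / (3 ^ n)%N%:R); first exact: p_integral_frac.
have {}qE : T%:~R = e%:~R * 3%:R ^+ n + q%:~R * p%:R ^+ 2 :> rat.
  have -> : T = e * 3%:Z ^+ n + q * p%:Z ^+ 2 by rewrite -qE; ring.
  by rewrite rmorphD !rmorphM !rmorphXn.
have {}rE : 3%:R ^+ n - 1 = r%:~R * p%:R :> rat.
  by have := congr1 (intr : int -> rat) rE; rewrite rmorphB rmorphM rmorphXn.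
rewrite qE rE natrX rmorphM /=.
by field.
Qed.
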